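(* Let $R$ be a nil clean ring which is of bounded index or a PI-ring. Then $R$ is strongly $\pi$-regular.
   Context: Rings are associative with unity, not necessarily commutative. A ring $R$ is nil clean if every element of $R$ can be written as a sum of an idempotent and a nilpotent of $R$. A ring $R$ is of bounded index (of nilpotence) if there exists a positive integer $n$ such that $x^n=0$ for every nilpotent $x\in R$. A ring $R$ is a PI-ring if $R$ satisfies a polynomial identity (in non-commuting indeterminates) with coefficients in $\mathbb{Z}$, at least one of whose coefficients is invertible. A ring $R$ is strongly $\pi$-regular if for every $a\in R$ there exists a positive integer $n$ such that $a^n\in a^{n+1}R$. *)

(* Defs.v *)
From HB Require Import structures.
From mathcomp Require Import all_boot all_order all_algebra.
From mathcomp Require Import finmap.
From mathcomp Require Import monalg.

Set Implicit Arguments.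
Unset Strict Implicit.
Unset Printing Implicit Defensive.

Import GRing.Theory.
Local Open Scope ring_scope.

(* Rings are [pzRingType]s: associative, unital, not necessarily commutative,
   the zero ring being allowed. *)

Definition is_idempotent (R : pzRingType) (e : R) : Prop := e * e = e.

Definition is_nilpotent (R : pzRingType) (x : R) : Prop :=
  exists n : nat, x ^+ n = 0.

Definition nil_clean (R : pzRingType) : Prop :=
  forall a : R, exists e x : R,
    [/\ is_idempotent e, is_nilpotent x & a = e + x].

Definition bounded_index (R : pzRingType) : Prop :=
  exists n : nat, (0 < n)%N /\ forall x : R, is_nilpotent x -> x ^+ n = 0.

(* [{fmonom nat}] is the free monoid (words) on the letters X_0, X_1, ..., so
   its monoid algebra over [int] is the free ring Z<X_0, X_1, ...>. *)
Definition ncpoly := {malg int[{fmonom nat}]}.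

(* The value of [f] under X_i |-> v i; [mmap] from [monalg] is not used since
   it requires a nonzero target ring. *)
Definition nceval (R : pzRingType) (v : nat -> R) (f : ncpoly) : R :=
  \sum_(m <- msupp f) (\prod_(i <- (m : seq nat)) v i) *~ f@_m.

Definition PI_ring (R : pzRingType) : Prop :=
  exists f : ncpoly,
    (exists m : {fmonom nat}, f@_m \is a GRing.unit) /\
    forall v : nat -> R, nceval v f = 0.

Definition strongly_pi_regular (R : pzRingType) : Prop :=
  forall a : R, exists n : nat,
    (0 < n)%N /\ exists r : R, a ^+ n = a ^+ n.+1 * r.

(* Main.v *)
(* The simple left modules are the [R / L] with [L] a maximal left ideal, here a
   predicate on [R].  Over such a module a sequence is independent when each
   term is moved by an element killing the later terms; a PI (staircase
   matrices) or a bound on the index (lifting a flag of idempotents and reading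
   off a long strictly triangular nilpotent) bounds the length of these
   sequences uniformly in [L].  Nil cleanness forces the endomorphism ring of
   [R / L] to be {0, 1}, so [R / L] has at most [2 ^ N] elements and
   [a ^ K - a ^ (K + K!)], with [K = 2 ^ N], annihilates every simple module.
   It thus lies in the Jacobson radical, which is nil in a nil clean ring. *)

Require Import Defs.
From mathcomp Require Import all_boot all_order all_algebra.
From mathcomp Require Import finmap monalg.
From mathcomp Require Import boolp classical_sets.

Set Implicit Arguments.
Unset Strict Implicit.
Unset Printing Implicit Defensive.

Import GRing.Theory.
Local Open Scope ring_scope.

(** * Left ideals and independent sequences *)

Definition left_ideal (R : pzRingType) (L : R -> Prop) : Prop :=
  [/\ L 0, forall x y, L x -> L y -> L (x + y) & forall r x, L x -> L (r * x)].

Definition maximal_left_ideal (R : pzRingType) (L : R -> Prop) : Prop :=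
  [/\ left_ideal L, ~ L 1 & forall x, ~ L x -> exists r, L (r * x - 1)].

(** For [L] maximal this is, by Jacobson density, linear independence of the classes over the
    endomorphism ring of [R / L], phrased through annihilators so that no scalars appear. *)
Fixpoint indep (R : pzRingType) (L : R -> Prop) (s : seq R) : Prop :=
  if s is x :: s' then
    (exists a, (forall y, y \in s' -> L (a * y)) /\ ~ L (a * x)) /\ indep L s'
  else True.

Fixpoint subset_sums (R : pzRingType) (s : seq R) : seq R :=
  if s is x :: s' then subset_sums s' ++ [seq x + y | y <- subset_sums s']
  else [:: 0].

Lemma size_subset_sums (R : pzRingType) (s : seq R) :
  size (subset_sums s) = (2 ^ size s)%N.
Proof.
by elim: s => //= x s IHs; rewrite size_cat size_map IHs expnS mul2n addnn.
Qed.

Section LeftIdeal.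
Variables (R : pzRingType) (L : R -> Prop).
Hypothesis idL : left_ideal L.

Lemma li0 : L 0. Proof. by case: idL. Qed.
Lemma liD x y : L x -> L y -> L (x + y). Proof. by case: idL => _ + _; exact. Qed.
Lemma liM r x : L x -> L (r * x). Proof. by case: idL => _ _; exact. Qed.
Lemma liN x : L x -> L (- x). Proof. by move=> /(liM (- 1)); rewrite mulN1r. Qed.
Lemma liB x y : L x -> L y -> L (x - y).
Proof. by move=> Lx /liN; exact: liD. Qed.
Lemma li_sym x y : L (x - y) -> L (y - x). Proof. by move=> /liN; rewrite opprB. Qed.
Lemma li_trans y x z : L (x - y) -> L (y - z) -> L (x - z).
Proof. by move=> Lxy Lyz; rewrite -(subrKA y); exact: liD. Qed.
Lemma li_mem y x : L (x - y) -> L y -> L x.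
Proof. by move=> Lxy Ly; rewrite -(subrK y x); exact: liD. Qed.
Lemma li_memr y x : L (x - y) -> L x -> L y.
Proof. by move=> /li_sym; exact: li_mem. Qed.
Lemma li_sum (I : Type) (s : seq I) (P : pred I) (F : I -> R) :
  (forall i, P i -> L (F i)) -> L (\sum_(i <- s | P i) F i).
Proof. by move=> LF; apply: (big_ind L) => //; [exact: li0|exact: liD]. Qed.

End LeftIdeal.

(** * Density and endomorphisms of the simple module [R / L] *)

Section SimpleModule.
Variables (R : pzRingType) (L : R -> Prop).
Hypothesis maxL : maximal_left_ideal L.

Let idL : left_ideal L. Proof. by case: maxL. Qed.
Let L1 : ~ L 1. Proof. by case: maxL. Qed.

Lemma simple_hit x y : ~ L x -> exists r, L (r * x - y).
Proof.
case: maxL => _ _ + nLx => /(_ x nLx)[r Lr]; exists (y * r).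
by rewrite -mulrA -{2}(mulr1 y) -mulrBr; exact: (liM idL).
Qed.

(* [x |-> x * d] is an endomorphism of the simple module [R / L], hence
   injective unless it is zero. *)
Lemma idealizer_inj d x :
  (forall r, L r -> L (r * d)) -> ~ L d -> L (x * d) -> L x.
Proof.
move=> Ld nLd Lxd; apply: contrapT => nLx; have [r Lr] := simple_hit 1 nLx.
apply: nLd; have := Ld _ Lr; rewrite mulrBl mul1r -mulrA => L2.
by apply: (li_mem idL (li_sym idL L2)); exact: (liM idL).
Qed.

(** Jacobson density: an element killing the tail and moving the head corrects the value at the head
    without disturbing the others. *)
Lemma indep_interpolation s (phi : R -> R) :
  indep L s -> exists a, forall x, x \in s -> L (a * x - phi x).
Proof.
elim: s => [_|x s IHs /= [[a [as0 ax]] /IHs[b bs]]]; first by exists 0.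
have [r Lr] := simple_hit (phi x - b * x) ax.
exists (b + r * a) => y; rewrite inE => /orP[/eqP->|ys].
  by move: Lr; rewrite opprB addrA mulrDl -mulrA (addrC (b * x)).
rewrite mulrDl -mulrA addrAC; apply: (liD idL) => //; first exact: bs.
by apply: (liM idL) => //; exact: as0.
Qed.

Lemma indep_uniq s : indep L s -> uniq s.
Proof.
elim: s => //= x s IHs [[a [as0 ax]] /IHs->]; rewrite andbT.
by apply/negP => /as0.
Qed.

Lemma indep_notin s x : indep L s -> x \in s -> ~ L x.
Proof.
elim: s => //= y s IHs [[a [_ ay]] /IHs {}IHs]; rewrite inE => /orP[/eqP->|//].
by move=> /(liM idL a).
Qed.

Lemma indep_dual s : indep L s -> exists g : R -> R, forall x y,
  y \in s -> L (g x * y - (if y == x then x else 0)).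
Proof.
move=> inds.
pose phi (x y : R) := if y == x then x else 0.
have [g gP] := choice (fun x => indep_interpolation (phi x) inds).
by exists g => x; exact: gP.
Qed.

Lemma subset_sumsP s (f : R -> R) :
  (forall x, x \in s -> L (f x) \/ L (f x - x)) ->
  exists2 t, t \in subset_sums s & L (\sum_(x <- s) f x - t).
Proof.
elim: s => [|x s IHs] fs /=.
  by exists 0; rewrite ?inE // big_nil subr0; exact: (li0 idL).
have [y ys|t ts Lt] := IHs; first by apply: fs; rewrite inE ys orbT.
rewrite big_cons; case: (fs x (mem_head _ _)) => Lx.
  by exists t; [rewrite mem_cat ts|rewrite -addrA; exact: (liD idL)].
exists (x + t); first by rewrite mem_cat (map_f (+%R x)) ?orbT.
by rewrite opprD addrACA; exact: (liD idL).
Qed.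

(* Pigeonhole on the residues mod [L] of [y, a y, a^2 y, ...]. *)
Lemma power_period (T : seq R) K (a y : R) :
    (forall z, exists2 t, t \in T & L (z - t)) -> (size T <= K)%N ->
  L ((a ^+ K - a ^+ (K + K`!)) * y).
Proof.
move=> repT leTK.
have repT' i : exists t, t \in T /\ L (a ^+ i * y - t).
  by have [t] := repT (a ^+ i * y); exists t.
have [f fP] := choice repT'.
have [i [p [p0 leK Lip]]] : exists i p,
    [/\ (0 < p)%N, (i + p <= K)%N & L (a ^+ i * y - a ^+ (i + p) * y)].
  have : ~~ uniq [seq f i | i <- iota 0 K.+1].
    apply/negP => uniq_f; have subT : {subset [seq f i | i <- iota 0 K.+1] <= T}.
      by move=> _ /mapP[i _ ->]; case: (fP i).
    by have := uniq_leq_size uniq_f subT; rewrite size_map size_iota ltnNge leTK.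
  move=> /(uniqPn 0)[i [j [ltij]]]; rewrite size_map size_iota => ltjK.
  have ltiK := ltn_trans ltij ltjK.
  rewrite !(nth_map 0%N) ?size_iota // !nth_iota // !add0n => fij.
  exists i, (j - i)%N; rewrite subn_gt0 (subnKC (ltnW ltij)); split => //.
  apply: (li_trans idL (fP i).2).
  by rewrite fij; apply: (li_sym idL); exact: (fP j).2.
have Lk k : L (a ^+ i * y - a ^+ (i + k * p) * y).
  elim: k => [|k IHk]; first by rewrite mul0n addn0 subrr; exact: (li0 idL).
  apply: (li_trans idL IHk).
  rewrite mulSn addnA ![(_ + k * p)%N]addnC !exprD -!mulrA -mulrBr mulrA -exprD.
  exact: (liM idL).
(* As [0 < p <= K], the period [p] divides [K!]; and [i <= K] puts [a ^+ K] past the preperiod. *)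
have [q Kq] : exists q, K`! = (q * p)%N.
  apply/dvdnP/dvdn_fact; rewrite p0 /=.
  exact: leq_trans (leq_addl i p) leK.
have leiK : (i <= K)%N := leq_trans (leq_addr p i) leK.
rewrite Kq -{1 2}(subnK leiK) -addnA !exprD -mulrBr -mulrA -exprD mulrBl.
by apply: (liM idL).
Qed.

(* With [A = d * g = e + q], [A] sends [R / L] into the image of [1] under its
   endomorphisms, so [q^2 = q (d - 1) + (d - A e)] modulo [L] with
   coefficients [d - 1] and [d - A e] in the idealizer. *)
Lemma nil_clean_endo_trivial g d :
    nil_clean R -> L (g - 1) -> (forall r y, L r -> L (r * g * y)) ->
    (forall r, L r -> L (r * d)) ->
  L d \/ L (d - 1).
Proof.
move=> ncR Lg1 Lg Ld; have [e [q [ee [k qk] Aeq]]] := ncR (d * g).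
have Ld1 r : L r -> L (r * (d - 1)).
  by move=> Lr; rewrite mulrBr mulr1; apply: (liB idL) => //; exact: Ld.
pose b := d * g * e.
have Leta r : L r -> L (r * (d - b)).
  move=> Lr; rewrite mulrBr; apply: (liB idL); first exact: Ld.
  by rewrite /b !mulrA; apply: Lg; exact: Ld.
have Lq : L (d - e - q).
  rewrite -addrA -opprD -Aeq -{1}(mulr1 d) -mulrBr; apply: (liM idL).
  exact: (li_sym idL).
have Lq2 : L (q * q - (q * (d - 1) + (d - b))).
  have -> : q * q - (q * (d - 1) + (d - b)) = - (q * (d - e - q)) - (d - e - q).
    rewrite /b Aeq mulrDl ee !mulrBr mulr1 [- (_ - q * q)]opprB -[RHS]addrA.
    rewrite -opprD; congr (_ - _).
    by rewrite opprD [d + _]addrA addrACA [- q + _]addrC addrACA.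
  by apply: (liB idL) => //; apply: (liN idL); exact: (liM idL).
(* If [d - b] is not in [L], multiplying [Lq2] by [q ^+ j] shows that [q ^+ j.+1] in [L] forces
   [q ^+ j] into [L]; descending from [q ^+ k = 0] reaches [1], a contradiction. *)
have [Le|nLe] := lem (L (d - b)); last first.
  have desc j : L (q ^+ j.+1) -> L (q ^+ j).
    move=> Lj; apply: (idealizer_inj Leta nLe).
    have /(liM idL (q ^+ j)) := Lq2.
    rewrite mulrBr mulrDr !mulrA -!exprSr opprD addrA => Lj2.
    apply: (li_memr idL Lj2); apply: (liB idL); last exact: Ld1.
    by rewrite exprS; exact: (liM idL).
  have : L (q ^+ k) by rewrite qk; exact: (li0 idL).
  by elim: k {qk} => [|k IHk] => [/L1|/desc].
have Lq3 : L (q * q - q * (d - 1)).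
  by apply: (li_mem idL _ Le); rewrite -addrA -opprD.
have [Ld1'|nLd1] := lem (L (d - 1)); first by right.
(* The same descent with [d - 1] stops at [q]; hence [d] agrees with [e] modulo [L] and acts as an
   idempotent endomorphism. *)
have desc j : L (q ^+ j.+2) -> L (q ^+ j.+1).
  move=> Lj; apply: (idealizer_inj Ld1 nLd1).
  have /(liM idL (q ^+ j)) := Lq3.
  by rewrite mulrBr !mulrA -!exprSr => /(li_memr idL); apply.
have : L (q ^+ k.+1) by rewrite exprS qk mulr0; exact: (li0 idL).
have {}desc : L (q ^+ k.+1) -> L q by elim: k {qk} => // k IHk /desc.
move=> /desc Lq1; have Lde : L (d - e) by apply: (li_mem idL Lq).
have Ldd : L (d * (d - 1)).
  rewrite mulrBr mulr1; apply: (li_trans idL (y := e * d)).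
    by rewrite -mulrBl; exact: Ld.
  apply: (li_trans idL (y := e)); last exact: (li_sym idL).
  by rewrite -{2}ee -mulrBr; exact: (liM idL).
by left; exact: (idealizer_inj Ld1 nLd1 Ldd).
Qed.

(** [R / L] is also [R] modulo the annihilator of [x], with [x] in the role of [1]; this carries
    [nil_clean_endo_trivial] over to any nonzero class. *)
Lemma annihilator_maximal x :
  ~ L x -> maximal_left_ideal (fun r => L (r * x)).
Proof.
move=> nLx; split; [split|by rewrite mul1r|].
- by rewrite mul0r; exact: (li0 idL).
- by move=> r t Lr Lt; rewrite mulrDl; exact: (liD idL).
- by move=> r t Lt; rewrite -mulrA; exact: (liM idL).
move=> y /(simple_hit x)[r Lr]; exists r.
by rewrite mulrBl mul1r -mulrA.
Qed.

(** If [b] kills [s] but moves [z], then [z :: s] is independent and longer; the length bound stops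
    this growth. *)
Lemma indep_maximal N : (forall s, indep L s -> (size s < N)%N) ->
  exists s, indep L s /\
    forall b, (forall y, y \in s -> L (b * y)) -> forall z, L (b * z).
Proof.
move=> indN; apply: contrapT => nomax.
have [s [/indN + sN]] : exists s, indep L s /\ size s = N.
  elim: {indN} N => [|n [s [inds sn]]]; first by exists [::].
  apply: contrapT => nos; apply: nomax; exists s; split=> // b bs z.
  apply: contrapT => nbz; apply: nos; exists (z :: s); rewrite /= sn.
  by split=> //; split=> //; exists b.
by rewrite sN ltnn.
Qed.

End SimpleModule.

(** * Finiteness of the simple modules *)

Lemma nil_clean_finite_quotient (R : pzRingType) (L : R -> Prop) N :
    nil_clean R -> maximal_left_ideal L ->
    (forall s, indep L s -> (size s < N)%N) ->
  exists2 T : seq R, (size T <= 2 ^ N)%N &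
    forall z, exists2 t, t \in T & L (z - t).
Proof.
move=> ncR maxL indN; have [idL _ _] := maxL.
have [s [inds maxs]] := indep_maximal indN.
have [g gP] := indep_dual maxL inds.
exists (subset_sums s).
  by rewrite size_subset_sums leq_exp2l // ltnW // indN.
have gx x : x \in s -> L (g x * x - x).
  by move=> xs; have := gP x x xs; rewrite eqxx.
(* If [r] kills [x], then [r * g x] kills [s], hence everything; so an endomorphism of [R / L] sends
   [x] to [g x * z], and it is 0 or 1. *)
have line x z : x \in s -> L (g x * z) \/ L (g x * z - x).
  move=> xs; have nLx := indep_notin maxL inds xs.
  have Lrg r y : L (r * x) -> L (r * g x * y).
    move=> Lrx; apply: maxs => {}y ys; rewrite -mulrA.
    apply: (li_mem idL (y := r * (if y == x then x else 0))).
      by rewrite -mulrBr; apply: (liM idL); exact: gP.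
    by case: eqP => // _; rewrite mulr0; exact: (li0 idL).
  have [t Lt] := simple_hit maxL (g x * z) nLx.
  have := nil_clean_endo_trivial (annihilator_maximal maxL nLx) (g := g x) (d := t) ncR.
  rewrite !mulrBl !mul1r => /(_ (gx x xs)).
  case=> [r y Lr|r Lr||].
  - by rewrite -mulrA; exact: Lrg.
  - rewrite -mulrA; apply: (li_mem idL (y := r * (g x * z))).
      by rewrite -mulrBr; exact: (liM idL).
    by rewrite mulrA; exact: Lrg.
  - by move=> Ltx; left; exact: (li_memr idL Lt).
  by move=> Ltx; right; apply: (li_trans idL _ Ltx); exact: (li_sym idL).
move=> z; have [t ts Lt] := subset_sumsP maxL (f := fun x => g x * z) (s := s)
  (fun x xs => line x z xs).
exists t => //; apply: (li_trans idL _ Lt).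
(* [1 - \sum_(x <- s) g x] kills [s], hence [z]. *)
rewrite -mulr_suml -{1}(mul1r z) -mulrBl; apply: maxs => y ys.
rewrite mulrBl mul1r mulr_suml (bigD1_seq y) //=; last exact: indep_uniq inds.
rewrite opprD addrA; apply: (liB idL); first exact: (li_sym idL (gx y ys)).
rewrite big_seq_cond; apply: (li_sum idL) => x /andP[xs yx].
by have := gP x y ys; rewrite eq_sym (negPf yx) subr0.
Qed.

(** * Zorn's lemma and the Jacobson radical *)

Lemma zorn_maximal_left_ideal (R : pzRingType) (c : R) :
    (forall r, r * c <> 1) ->
  exists2 L : R -> Prop, maximal_left_ideal L & L c.
Proof.
move=> nc1.
(* [P] must hold of the empty set, the union of the empty chain, so [0] is only adjoined later, in
   [I0]. The last clause keeps [1] out of [I + R c]. *)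
pose P (I : set R) := [/\ forall x y, I x -> I y -> I (x + y),
  forall r x, I x -> I (r * x) & forall x r, I x -> x + r * c <> 1].
have [F FP tF|I [[ID IM I1] maxI]] := @Zorn_bigcup R P.
  split.
  - move=> x y [X FX Xx] [Y FY Yy]; have [XY|YX] := tF _ _ FX FY.
      by exists Y => //; have [D _ _] := FP _ FY; apply: D => //; exact: XY.
    by exists X => //; have [D _ _] := FP _ FX; apply: D => //; exact: YX.
  - by move=> r x [X FX Xx]; exists X => //; have [_ M _] := FP _ FX; exact: M.
  - by move=> x r [X FX Xx]; have [_ _ X1] := FP _ FX; exact: X1.
pose I0 y := I y \/ y = 0.
have I0D y z : I0 y -> I0 z -> I0 (y + z).
  case=> [Iy|->]; last by rewrite add0r.
  by case=> [Iz|->]; left; [exact: ID|rewrite addr0].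
have I0M r y : I0 y -> I0 (r * y).
  by case=> [Iy|->]; [left; exact: IM|right; rewrite mulr0].
have inI x : (forall y r s, I0 y -> y + r * x + s * c <> 1) -> I x.
  move=> Px; apply: contrapT => nIx.
  apply: (maxI [set z | exists y r, I0 y /\ z = y + r * x]%classic).
    split=> [z Iz|/(_ x) BI]; first by exists z, 0; rewrite mul0r addr0; split=> //; left.
    by apply/nIx/BI; exists 0, 1; rewrite mul1r add0r; split=> //; right.
  split.
  - move=> _ _ [y [r [Iy ->]]] [z [s [Iz ->]]]; exists (y + z), (r + s).
    by rewrite addrACA mulrDl; split=> //; exact: I0D.
  - move=> s _ [y [r [Iy ->]]]; exists (s * y), (s * r).
    by rewrite mulrDr mulrA; split=> //; exact: I0M.
  - by move=> _ s [y [r [Iy ->]]]; exact: Px.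
have Ic : I c.
  apply: inI => y r s [Iy|->]; rewrite -addrA -mulrDl; first exact: I1.
  by rewrite add0r.
have I_0 : I 0 by rewrite -(mul0r c); exact: IM.
exists I => //; split=> //; first by move=> /(I1 1 0); rewrite mul0r addr0.
move=> x nIx; apply: contrapT => nr; apply/nIx/inI => y r s Iy eq1; apply: nr.
exists r; rewrite -eq1 [y + _]addrC -addrA opprD addrA subrr sub0r -mulN1r.
apply: (IM); apply: ID; last exact: IM.
by case: Iy => [|->].
Qed.

(** For [x = e + q], having [x * e] in [L] means [e = - q * e] modulo [L], so nilpotency of [q] puts
    [e] in every maximal left ideal. Then [1 - e] is left invertible, and [(1 - e) * e = 0] gives
    [e = 0]. *)
Lemma nil_clean_radical_nil (R : pzRingType) (x : R) : nil_clean R ->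
    (forall L, maximal_left_ideal L -> forall r, L (x * r)) ->
  is_nilpotent x.
Proof.
move=> ncR Jx; have [e [q [ee [k qk] xeq]]] := ncR x.
exists k; suff e0 : e = 0 by rewrite xeq e0 add0r.
have Je L : maximal_left_ideal L -> L e.
  move=> maxL; have [idL L1 _] := maxL.
  have Lq j : L (e - (- q) ^+ j * e).
    elim: j => [|j IHj]; first by rewrite expr0 mul1r subrr; exact: (li0 idL).
    apply: (li_trans idL (y := - q * e)).
      by rewrite -{1}ee mulNr opprK -mulrDl -xeq; exact: Jx.
    by rewrite exprS -mulrA -mulrBr; exact: (liM idL).
  by have := Lq k; rewrite exprNn qk mulr0 mul0r subr0.
have [[r r1]|nr] := lem (exists r, r * (1 - e) = 1).
  by rewrite -[e]mul1r -r1 -mulrA mulrBl mul1r ee subrr mulr0.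
have [|L maxL L1e] := @zorn_maximal_left_ideal R (1 - e).
  by move=> r r1; apply: nr; exists r.
have [idL L1 _] := maxL; case: L1.
by rewrite -(subrK e 1); apply: (liD idL) => //; exact: Je.
Qed.

(** * Strong pi-regularity from a uniform length bound *)

Lemma nil_clean_strongly_pi_regular (R : pzRingType) N : nil_clean R ->
    (forall L, maximal_left_ideal L ->
      forall s : seq R, indep L s -> (size s < N)%N) ->
  strongly_pi_regular R.
Proof.
move=> ncR indN a; pose K := (2 ^ N)%N; pose p := K`!.
have [k] : is_nilpotent (a ^+ K - a ^+ (K + p)).
  apply: (nil_clean_radical_nil ncR) => L maxL y.
  have [T leT repT] := nil_clean_finite_quotient ncR maxL (indN L maxL).
  exact: (power_period maxL).
have -> : a ^+ K - a ^+ (K + p) = a ^+ K * (1 - a ^+ p).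
  by rewrite exprD mulrBr mulr1.
rewrite exprMn_comm; last first.
  by apply: commrB; [exact: commr1|apply: commrX; apply: commr_sym; exact: commrX].
rewrite -exprM => eq0.
(* The successor keeps the exponent positive when [k = 0]. *)
exists (K * k).+1; split=> //.
have [r] : exists r, (1 - a ^+ p) ^+ k = 1 - a * r.
  have -> : p = p.-1.+1 by rewrite prednK // fact_gt0.
  elim: {eq0} k => [|k [r IHk]]; first by exists 0; rewrite mulr0 subr0.
  exists (r + a ^+ p.-1 * (1 - a * r)).
  by rewrite exprS IHk mulrBl mul1r [a ^+ _.+1]exprS [in RHS]mulrDr opprD addrA mulrA.
move=> r1; exists r; rewrite exprS [in RHS]exprS -mulrA; congr (_ * _).
rewrite exprSr -mulrA; apply/eqP; rewrite -subr_eq0 -{1}[_ ^+ _]mulr1 -mulrBr -r1.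
exact/eqP.
Qed.

(** * Bounded index: long nilpotents from idempotents *)

Lemma nilpotent_add1_inv (R : pzRingType) (q : R) : is_nilpotent q ->
  exists v, v * (1 + q) = 1 /\ (1 + q) * v = 1.
Proof.
move=> [k qk]; exists (\sum_(i < k) (- q) ^+ i).
have comm : GRing.comm (1 + q) (\sum_(i < k) (- q) ^+ i).
  apply: commr_sum => i _; apply: commrX; apply: commrN; apply: commr_sym.
  by apply: commrD; [exact: commr1|].
rewrite -comm; suff -> : (1 + q) * (\sum_(i < k) (- q) ^+ i) = 1 by [].
apply: oppr_inj; rewrite -mulNr opprD addrC -subrX1 exprNn qk mulr0.
by rewrite sub0r.
Qed.

(* Nicholson: nil clean rings are clean, and clean rings are exchange rings. *)
Lemma nil_clean_exchange (R : pzRingType) (a : R) : nil_clean R ->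
  exists f, [/\ f * f = f, exists r, f = r * a & exists t, 1 - f = t * (1 - a)].
Proof.
move=> ncR; have [e [q [ee /nilpotent_add1_inv[v [vu uv]] aeq]]] := ncR (a - 1).
have ueq : 1 + q = a - e.
  by rewrite -[a](subrK 1) aeq [e + q]addrC addrAC addrK addrC.
have e1e : (1 - e) * e = 0 by rewrite mulrBl mul1r ee subrr.
have e1e1 : (1 - e) * (1 - e) = 1 - e by rewrite mulrBr mulr1 e1e subr0.
exists (v * (1 - e) * (1 + q)); split.
- by rewrite -!mulrA (mulrA (1 + q)) uv mul1r (mulrA (1 - e)) e1e1.
- by exists (v * (1 - e)); rewrite ueq mulrBr -(mulrA v _ e) e1e mulr0 subr0.
exists (- (v * e)); rewrite mulrBr mulr1 mulrBl vu opprB addrC subrK ueq.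
by rewrite mulNr -mulrN opprB -!mulrA !mulrBr mulr1 ee.
Qed.

(** Induction inside corners [e R e]: split [e = f + h] into idempotents, where modulo [L] [f] fixes
    [x] and kills the tail while [h] fixes the tail. To a nilpotent [v0] of [h R h] for the tail is
    added a [w] leading from [x] to the start of its long chain. The factor [e] in the last clause
    matters at exponent [0]. *)
Lemma nil_clean_long_nilpotent (R : pzRingType) (L : R -> Prop) (s : seq R) x e :
    nil_clean R -> maximal_left_ideal L -> indep L (x :: s) -> e * e = e ->
    (forall y, y \in x :: s -> L (e * y - y)) ->
  exists v, [/\ e * v = v, v * e = v, v ^+ (size s).+1 = 0 &
    exists y, ~ L (v ^+ size s * e * y)].
Proof.
move=> ncR maxL; have [idL _ _] := maxL.
elim: s x e => [|z s IHs] x e inds ee ex.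
  exists 0; rewrite mulr0 mul0r expr1; split=> //; exists x; rewrite expr0 mul1r.
  have nLx := indep_notin maxL inds (mem_head _ _).
  by move=> /(li_memr idL (ex _ (mem_head _ _))).
have [g gP] := indep_dual maxL inds; pose a := g x.
have ax : L (a * x - x) by have := gP x x (mem_head _ _); rewrite eqxx.
have as0 y : y \in z :: s -> L (a * y).
  move=> ys; have := gP x y; rewrite inE ys orbT => /(_ isT).
  case: eqP => [yx|_]; last by rewrite subr0.
  by have := indep_uniq inds; rewrite cons_uniq -yx ys.
have eL y : L (e * y - y) -> forall r, L (r * e * y - r * y).
  by move=> Ly r; rewrite -mulrA -mulrBr; exact: (liM idL).
(* [e * a * e] fixes [x] and kills the tail modulo [L]; exchange yields an idempotent [f0] doing the
   same, and [e * f0] lies in [e R e]. *)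
have [f0 [f0f0 [r f0r] [t f0t]]] := nil_clean_exchange (e * a * e) ncR.
have f0e : f0 * e = f0 by rewrite f0r -!mulrA ee.
pose f := e * f0; have fe : f * e = f by rewrite /f -mulrA f0e.
have ef : e * f = f by rewrite /f mulrA ee.
have ff : f * f = f by rewrite {2}/f mulrA fe /f -mulrA f0f0.
have fx : L (f * x - x).
  have exx := ex x (mem_head _ _).
  have bx : L (e * a * e * x - x).
    apply: (li_trans idL (eL _ exx _)); apply: (li_trans idL _ exx).
    by rewrite -mulrA -mulrBr; exact: (liM idL).
  apply: (li_trans idL _ exx); rewrite /f -mulrA -mulrBr; apply: (liM idL).
  apply: (li_sym idL); rewrite -{1}(mul1r x) -mulrBl f0t -(mulrA t); apply: (liM idL).
  by rewrite mulrBl mul1r; exact: (li_sym idL).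
have fs y : y \in z :: s -> L (f * y).
  move=> ys; have eyy : L (e * y - y) by apply: ex; rewrite inE ys orbT.
  rewrite /f f0r !mulrA; apply: (li_mem idL (eL _ eyy _)).
  by rewrite -mulrA; apply: (liM idL); exact: as0.
clearbody f; pose h := e - f.
have hh : h * h = h.
  by rewrite /h mulrBl !mulrBr ee ef fe ff subrr subr0.
have fh : f * h = 0 by rewrite /h mulrBr fe ff subrr.
have he : h * e = h by rewrite /h mulrBl ee fe.
have eh : e * h = h by rewrite /h mulrBr ee ef.
have [|y ys|v0 [hv0 v0h v0n [y nLy]]] := IHs z h _ hh; first by case: inds.
  rewrite /h mulrBl addrAC; apply: (liB idL); last exact: fs.
  by apply: ex; rewrite inE ys orbT.
(* Modulo [L], [w] carries [x] to [h * y], which [v0 ^+ size s] does not kill; [w * v0 = w * w = 0]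
   leaves one mixed term in each power. *)
have [r' Lr'] := simple_hit maxL y (indep_notin maxL inds (mem_head _ _)).
pose w := h * r' * f.
have wv0 : w * v0 = 0 by rewrite /w -mulrA -hv0 (mulrA f) fh mul0r mulr0.
have ww : w * w = 0 by rewrite /w !mulrA -(mulrA _ f) fh mulr0 !mul0r.
have vX j : (v0 + w) ^+ j.+1 = v0 ^+ j.+1 + v0 ^+ j * w.
  elim: j => [|j IHj]; first by rewrite !expr1 expr0 mul1r.
  by rewrite exprSr IHj mulrDl !mulrDr -!exprSr -!(mulrA _ w) wv0 ww !mulr0 !addr0.
exists (v0 + w); split.
- by rewrite mulrDr -hv0 /w !mulrA eh.
- by rewrite mulrDl -v0h /w -!mulrA he fe.
- by rewrite vX exprSr v0n !mul0r addr0.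
exists x; rewrite vX v0n add0r /w !mulrA -(mulrA _ f) fe => Lx; apply: nLy.
apply: (li_memr idL _ Lx); apply: (li_trans idL (y := v0 ^+ size s * h * r' * x)).
  by rewrite -mulrA -mulrBr; exact: (liM idL).
by rewrite -mulrA -mulrBr; exact: (liM idL).
Qed.

Lemma bounded_index_indep (R : pzRingType) (L : R -> Prop) n s :
    nil_clean R -> (forall x : R, is_nilpotent x -> x ^+ n = 0) ->
    maximal_left_ideal L -> indep L s -> (size s < n.+1)%N.
Proof.
move=> ncR bn maxL; have [idL _ _] := maxL.
case: s => // x s inds; rewrite ltnS leqNgt; apply/negP => /= ltns.
have [||v [_ _ vs [y]]] := nil_clean_long_nilpotent ncR maxL inds (e := 1).
- by rewrite mulr1.
- by move=> y _; rewrite mul1r subrr; exact: (li0 idL).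
case; rewrite -(subnK (ltns : (n <= size s)%N)) exprD bn; last by exists (size s).+1.
by rewrite mulr0 !mul0r; exact: (li0 idL).
Qed.

(** * Polynomial identities: evaluation on staircase matrices *)

(* The staircase: on [x_j = nth 0 s j], the letter [i] sends [x_(j+1)] to
   [x_j] when the [j]-th letter of [m] is [i], and kills it otherwise; so a
   word survives on the last [x_j] iff it is a suffix of [m]. *)
Lemma indep_staircase (R : pzRingType) (L : R -> Prop) (s : seq R) (m : seq nat) :
    maximal_left_ideal L -> indep L s -> (size m < size s)%N ->
  exists v : nat -> R,
    (forall p w, m = p ++ w ->
       L ((\prod_(i <- w) v i) * s`_(size m) - s`_(size p))) /\
    (forall w, ~ (exists p, m = p ++ w) ->
       L ((\prod_(i <- w) v i) * s`_(size m))).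
Proof.
move=> maxL inds ltms; have [idL _ _] := maxL; have us := indep_uniq inds.
pose next i k := if (0 < k <= size m)%N && (nth 0%N m k.-1 == i)
  then s`_k.-1 else 0.
have [v vP] := choice (fun i =>
  indep_interpolation maxL (fun y => next i (index y s)) inds).
have vs i k : (k <= size m)%N -> L (v i * s`_k - next i k).
  move=> lekm; have ltks := leq_ltn_trans lekm ltms.
  by rewrite -{2}(index_uniq 0 ltks us); apply: vP; rewrite mem_nth.
have suff_w p w : m = p ++ w ->
    L ((\prod_(i <- w) v i) * s`_(size m) - s`_(size p)).
  elim: w p => [|i w IHw] p mE.
    by rewrite big_nil mul1r mE cats0 subrr; exact: (li0 idL).
  rewrite big_cons -mulrA; apply: (li_trans idL (y := v i * s`_(size p).+1)).
    rewrite -mulrBr; apply: (liM idL).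
    by have := IHw (rcons p i); rewrite cat_rcons size_rcons; apply.
  have lepm : ((size p).+1 <= size m)%N.
    by rewrite mE size_cat /= addnS ltnS leq_addr.
  have := vs i _ lepm; rewrite /next lepm /=.
  by rewrite mE nth_cat ltnn subnn eqxx.
exists v; split=> //; elim=> [|i w IHw] nsuff.
  by case: nsuff; exists m; rewrite cats0.
rewrite big_cons -mulrA.
have [[p mE]|nw] := lem (exists p, m = p ++ w); last by apply: (liM idL); exact: IHw.
apply: (li_mem idL (y := v i * s`_(size p))).
  by rewrite -mulrBr; apply: (liM idL); exact: suff_w.
have lepm : (size p <= size m)%N by rewrite mE size_cat leq_addr.
apply: (li_mem idL (vs i _ lepm)); rewrite /next lepm andbT.
(* If [p] is empty, every letter kills the first term of [s]; otherwise the last letter of [p]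
   differs from [i], as [i :: w] is not a suffix of [m]. *)
case/lastP: p mE {lepm} => [|p c] mE /=; first exact: (li0 idL).
rewrite size_rcons /= mE nth_cat size_rcons leqnn nth_rcons ltnn eqxx.
case: eqP => [ci|_]; last exact: (li0 idL).
by case: nsuff; exists p; rewrite mE ci cat_rcons.
Qed.

(** Evaluate the identity on the staircase, at the term of index [size m]. Words that are not
    suffixes of [m] vanish and proper suffixes end on terms killed by [a], so only the coefficient
    of [m] survives; being a unit, it would put the first term of [s] in [L]. *)
Lemma PI_indep (R : pzRingType) (L : R -> Prop) (f : ncpoly) (m : {fmonom nat}) s :
    f@_m \is a GRing.unit -> (forall v : nat -> R, nceval v f = 0) ->
    maximal_left_ideal L -> indep L s -> (size s < (size (m : seq nat)).+1)%N.
Proof.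
move=> fm f0 maxL inds; have [idL _ _] := maxL; rewrite ltnS leqNgt.
apply/negP => ltms.
have [v [vsuff vnsuff]] := indep_staircase maxL inds ltms.
have [g gP] := indep_dual maxL inds; pose a := g s`_0.
have s0 : (0 < size s)%N := leq_ltn_trans (leq0n _) ltms.
have kill (w : {fmonom nat}) : w != m ->
    L (a * (\prod_(i <- (w : seq nat)) v i) * s`_(size (m : seq nat))).
  move=> neqwm; rewrite -mulrA.
  have [[p mE]|/vnsuff Lw] := lem (exists p, (m : seq nat) = p ++ w); last exact: (liM idL).
  apply: (li_mem idL (y := a * s`_(size p))).
    by rewrite -mulrBr; apply: (liM idL); exact: vsuff.
  have ltps : (size p < size s)%N.
    by apply: leq_ltn_trans ltms; rewrite mE size_cat leq_addr.
  have := gP s`_0 _ (mem_nth 0 ltps).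
  rewrite nth_uniq ?(indep_uniq inds) //; case: eqP => [/size0nil p0|_]; last by rewrite subr0.
  by case/eqP: neqwm; apply: val_inj; rewrite /= mE p0.
have hit : L (a * (\prod_(i <- (m : seq nat)) v i) * s`_(size (m : seq nat)) - s`_0).
  have := gP s`_0 _ (mem_nth 0 s0); rewrite eqxx; apply: (li_trans idL).
  rewrite -mulrA -mulrBr; apply: (liM idL).
  exact: (vsuff [::]).
have Lint x (c : int) : L x -> L (x *~ c) by rewrite -mulrzl; exact: (liM idL).
have eval0 : a * nceval v f * s`_(size (m : seq nat)) = 0 by rewrite f0 mulr0 mul0r.
apply: (indep_notin maxL inds (mem_nth 0 s0)).
apply: (li_memr idL hit).
rewrite /nceval mulr_sumr mulr_suml (bigD1_seq m) /= in eval0.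
- set X := _ * s`__; set c := f@_m in fm eval0.
  rewrite mulrzAr mulrzAl in eval0.
  have Lc : L (X *~ c).
    rewrite -[X *~ c](addrK (\sum_(i <- msupp f | i != m)
      a * ((\prod_(i <- (i : seq nat)) v i) *~ f@_i) * s`_(size (m : seq nat)))) eval0 sub0r.
    apply: (liN idL); apply: (li_sum idL) => w /kill Lw.
    by rewrite mulrzAr mulrzAl; exact: Lint.
  have := Lint _ c^-1 Lc; rewrite -mulrzA mulrV // mulr1z; exact.
- by rewrite -mcoeff_neq0; apply: contraTneq fm => ->; rewrite unitr0.
exact: fset_uniq.
Qed.

Theorem corollary3p12 (R : pzRingType) :
  nil_clean R -> bounded_index R \/ PI_ring R -> strongly_pi_regular R.
Proof.
move=> ncR [[n [_ bn]]|[f [[m fm] f0]]].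
  apply: (nil_clean_strongly_pi_regular (N := n.+1) ncR) => L maxL s.
  exact: bounded_index_indep.
apply: (nil_clean_strongly_pi_regular (N := (size (m : seq nat)).+1) ncR) => L maxL s.
exact: (PI_indep fm f0 maxL).
Qed.
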